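(* Let $\varepsilon,\delta>0$ be constants. There does not exist an $O(n^{1-\varepsilon})$-straying algorithm for weighted token swapping on trees which, on every instance, outputs a valid solution of cost at most $\left(1+\frac{W}{w}-\delta\right)\cdot\mathrm{OPT}$, where $w$ and $W$ are the minimum and maximum token weights of the instance.
   Context: An instance of weighted token swapping consists of a connected simple undirected graph $G=(V,E)$ with $n=|V|$ vertices, a set $T$ of $n$ tokens, a weight function $\omega:T\to\mathbb{R}_{>0}$, and two bijections $v_0,v_f:T\to V$ (starting and destination vertices). At all times each vertex holds exactly one token; initially token $t$ is on $v_0(t)$. A swap along an edge $(u,u')\in E$ exchanges the tokens on $u$ and $u'$ and costs the sum of the weights of the two swapped tokens. A valid solution is a sequence of swaps after which every token $t$ is on $v_f(t)$; its cost is the sum of the costs of its swaps, and $\mathrm{OPT}$ is the minimum cost of a valid solution. When $G$ is a tree, $p(t)$ denotes the unique path in $G$ from $v_0(t)$ to $v_f(t)$. An algorithm is $\ell$-straying on an instance if, at every time during its execution, every token $t$ is at graph distance at most $\ell$ from the set of vertices of $p(t)$. An algorithm is $O(n^{1-\varepsilon})$-straying if there is a function $\ell(n)=O(n^{1-\varepsilon})$ such that on every instance with $n$ vertices the algorithm is $\ell(n)$-straying. *)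

(* Defs.v *)
From HB Require Import structures.
From mathcomp Require Import all_boot all_order all_algebra all_fingroup.
From mathcomp Require Import all_classical all_reals all_analysis.
Set Implicit Arguments.
Unset Strict Implicit.
Unset Printing Implicit Defensive.
Import Order.TTheory GRing.Theory Num.Theory.
Import numFieldNormedType.Exports.
Local Open Scope classical_set_scope.
Local Open Scope ring_scope.

Section Graph.
Variables (V : finType) (e : rel V).

(* [path.cycle] accepts [:: x; y] as soon as x and y are adjacent, whence the size
   condition. *)
Definition acyclic : Prop :=
  forall c : seq V, (2 < size c)%N -> ~~ (path.cycle e c && uniq c).

Definition connected_graph : Prop := forall x y : V, connect e x y.

Definition is_tree : Prop := connected_graph /\ acyclic.

(* As in path.v, the sequence p omits the starting vertex x. *)
Definition simple_path (x y : V) (p : seq V) : bool :=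
  [&& path e x p, last x p == y & uniq (x :: p)].

Definition the_path (x y : V) : seq V :=
  xget [::] [set p | simple_path x y p].

(* Length of a shortest walk; the value #|V| is taken only when there is no
   walk from x to y. *)
Definition gdist (x y : V) : nat :=
  \big[minn/#|V|]_(k < #|V| |
    [exists p : k.-tuple V, path e x p && (last x p == y)]) k.

End Graph.

(* Swaps are given by the two endpoints of the edge used. *)
Section Swapping.
Variables (R : realType) (V T : finType) (wt : T -> R).

Definition swap_step (pos : T -> V) (q : V * V) : T -> V :=
  fun t => tperm q.1 q.2 (pos t).

Definition placement (pos : T -> V) (s : seq (V * V)) : T -> V :=
  foldl swap_step pos s.

Definition swap_cost (pos : T -> V) (q : V * V) : R :=
  \sum_(t | (pos t == q.1) || (pos t == q.2)) wt t.

Fixpoint swaps_cost (pos : T -> V) (s : seq (V * V)) : R :=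
  if s is q :: s' then swap_cost pos q + swaps_cost (swap_step pos q) s'
  else 0.

End Swapping.

(* The bijections force #|token| = #|vertex|.  The vertex set is nonempty, so
   that the minimum and maximum weights exist. *)
Record instance (R : realType) := Instance {
  vertex : finType;
  token : finType;
  adj : rel vertex;
  weight : token -> R;
  start : token -> vertex;
  dest : token -> vertex;
  vertex_gt0 : (0 < #|vertex|)%N;
  adj_sym : symmetric adj;
  adj_irr : irreflexive adj;
  adj_conn : connected_graph adj;
  weight_gt0 : forall t, 0 < weight t;
  start_bij : bijective start;
  dest_bij : bijective dest
}.

Record tree_instance (R : realType) := TreeInstance {
  tree_inst :> instance R;
  tree_instP : is_tree (@adj R tree_inst)
}.

Section Instance.
Variables (R : realType) (I : instance R).

Definition swaps := seq (vertex I * vertex I).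

Definition valid_solution (s : swaps) : Prop :=
  all (fun q => adj q.1 q.2) s /\
  (forall t, placement (@start R I) s t = dest t).

Definition cost (s : swaps) : R := swaps_cost (@weight R I) (@start R I) s.

(* The infimum is attained: see [OPT_attained]. *)
Definition OPT : R := inf [set cost s | s in valid_solution].

(* See [min_weightP] and [max_weightP]. *)
Definition min_weight : R := inf (range (@weight R I)).
Definition max_weight : R := sup (range (@weight R I)).

Definition token_path (t : token I) : seq (vertex I) :=
  start t :: the_path (@adj R I) (start t) (dest t).

Definition near_path (l : R) (t : token I) (v : vertex I) : Prop :=
  exists2 u, u \in token_path t & (gdist (@adj R I) v u)%:R <= l.

(* [take k s] ranges over all prefixes of s, including [::] and s itself. *)
Definition straying_solution (l : R) (s : swaps) : Prop :=
  forall (k : nat) (t : token I),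
    near_path l t (placement (@start R I) (take k s) t).

End Instance.

Definition tree_algorithm (R : realType) := forall I : tree_instance R, swaps I.

Definition straying (R : realType) (l : nat -> R) (A : tree_algorithm R) :=
  forall I : tree_instance R, straying_solution (l #|vertex I|) (A I).

Definition O_straying (R : realType) (a : R) (A : tree_algorithm R) :=
  exists l : nat -> R,
    l =O_\oo (fun n : nat => n%:R `^ a) /\ straying l A.

Section Facts.

Lemma gdist_le (V : finType) (e : rel V) (x : V) (p : seq V) :
  path e x p -> (gdist e x (last x p) <= size p)%N.
Proof.
case/shortenP => p' ep' Up' sub.
have sp' : (size p' < #|V|)%N.
  by rewrite -[(_ < _)%N]/(size (x :: p') <= #|V|)%N -(card_uniqP Up') max_card.
apply: (@leq_trans (size p')); last first.
  by apply: uniq_leq_size => //; case/andP: Up'.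
rewrite /gdist.
have Pk : [exists q : (Ordinal sp').-tuple V,
    path e x q && (last x q == last x p')].
  by apply/existsP; exists (in_tuple p'); rewrite ep' /=.
have := mem_index_enum (Ordinal sp').
elim: (index_enum _) => // k r IH; rewrite inE big_cons.
case/orP => [/eqP <-|/IH le]; first by rewrite Pk geq_minl.
by case: ifP => // _; rewrite geq_min le orbT.
Qed.

Lemma gdist_attained (V : finType) (e : rel V) (x y : V) :
  connect e x y ->
  exists p, [/\ path e x p, last x p = y & size p = gdist e x y].
Proof.
case/connectP => p ep ->.
have : (gdist e x (last x p) < #|V|)%N.
  case/shortenP: ep => p' ep' Up' _; apply: leq_ltn_trans (gdist_le ep') _.
  by rewrite -[(_ < _)%N]/(size (x :: p') <= #|V|)%N -(card_uniqP Up') max_card.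
rewrite /gdist; elim/big_rec: _ => [|k d /existsP[q /andP[eq /eqP lq]] IH].
  by rewrite ltnn.
by case: (leqP k d) => // _ _; exists q; rewrite size_tuple.
Qed.

Lemma the_path_simple (V : finType) (e : rel V) (x y : V) :
  connect e x y -> simple_path e x y (the_path e x y).
Proof.
case/connectP => p ep ->; rewrite /the_path.
case/shortenP: ep => p' ep' Up' _.
case: xgetP => [q -> //|/(_ p')] /= H.
by case: H; rewrite /simple_path ep' Up' eqxx.
Qed.

(* In an acyclic graph, two simple paths with the same ends coincide. *)
Lemma simple_path_uniq (V : finType) (e : rel V) (x y : V) (p q : seq V) :
  symmetric e -> acyclic e ->
  simple_path e x y p -> simple_path e x y q -> p = q.
Proof.
move=> es ac; elim: p x q => [|a p IH] x [|b q] //.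
- move=> /and3P[_ /eqP <- _] /and3P[_ /eqP /= lq /andP[]].
  by rewrite -{1}lq mem_last.
- move=> /and3P[_ /eqP /= lp /andP[+ _]] /and3P[_ /eqP yx _].
  by move: yx => /= ->; rewrite -lp mem_last.
case: (eqVneq a b) => [<-|ab].
  move=> /and3P[/= /andP[_ ep] lp /andP[_ up]].
  move=> /and3P[/= /andP[_ eq] lq /andP[_ uq]].
  by congr (_ :: _); apply: (IH a); apply/and3P; split.
move=> /and3P[/= /andP[xa ep] /eqP lp /andP[xp up]].
move=> /and3P[/= /andP[xb eq] /eqP lq /andP[xq uq]].
exfalso.
pose e' := [rel u v | [&& e u v, u != x & v != x]].
have e's : symmetric e'.
  by move=> u v; rewrite /= es; congr (_ && _); rewrite andbC.
have cs := same_connect (sym_connect_sym e's).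
have avoid z r : path e z r -> x \notin z :: r -> connect e' z (last z r).
  move=> zr xr; apply/connectP; exists r => //.
  elim: r z zr xr => //= c r IHr z /andP[zc cr].
  rewrite !inE !negb_or => /and3P[xz xc xr].
  rewrite zc eq_sym xz eq_sym xc IHr //.
  by rewrite inE negb_or xc.
have cab : connect e' a b.
  apply: (@connect_trans _ _ y).
    by rewrite -lp; apply: avoid.
  rewrite (sym_connect_sym e's) -lq; exact: avoid.
case/connectP: cab => r0 er0 lb; case/shortenP: er0 lb => r er ur _ lb.
have {er} [er xr] : path e a r /\ x \notin a :: r.
  have xa' : x \notin [:: a] by move: xp; rewrite !inE; case/norP.
  clear -er xa'; elim: r a er xa' => //= c r IHr a /andP[/and3P[ac ax cx] cr] xa.
  have [|cr' xr] := IHr c cr; first by rewrite inE eq_sym.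
  split; first by rewrite ac.
  by rewrite inE negb_or xr eq_sym ax.
have := ac (x :: a :: r).
case: r er ur lb xr => [|c r] er ur lb xr.
  by move: ab; rewrite lb /= eqxx.
move=> /(_ isT) /negP; apply.
apply/andP; split; last by rewrite cons_uniq xr ur.
have -> : path.cycle e [:: x, a, c & r] =
    [&& e x a, path e a (c :: r) & e (last a (c :: r)) x].
  by rewrite /= rcons_path !andbA.
by rewrite xa er -lb es.
Qed.

Section Minima.
Variables (R : realType) (I : instance R).

Lemma token_inhabited : exists t : token I, True.
Proof.
have /card_gt0P[v _] := vertex_gt0 I.
by case: (start_bij I) => g _ _; exists (g v).
Qed.

Lemma inf_min (A : set R) (m : R) : A m -> (forall a, A a -> m <= a) -> inf A = m.
Proof.
move=> Am lb; apply/eqP; rewrite eq_le; apply/andP; split.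
  by apply: ge_inf => //; exists m.
by apply: lb_le_inf => //; exists m.
Qed.

Lemma min_weightP :
  (exists t : token I, weight t = min_weight I) /\
  (forall t : token I, min_weight I <= weight t).
Proof.
have [t0 _] := token_inhabited.
case: (@arg_minP _ _ _ t0 xpredT (@weight R I) isT) => t _ tmin.
rewrite /min_weight (@inf_min _ (weight t)).
- by split=> [|u]; [exists t|exact: tmin].
- by exists t.
- by move=> _ [u _ <-]; exact: tmin.
Qed.

Lemma max_weightP :
  (exists t : token I, weight t = max_weight I) /\
  (forall t : token I, weight t <= max_weight I).
Proof.
have [t0 _] := token_inhabited.
case: (@arg_maxP _ _ _ t0 xpredT (@weight R I) isT) => t _ tmax.
have -> : max_weight I = weight t.
  apply/eqP; rewrite eq_le; apply/andP; split.
    apply: ge_sup; first by exists (weight t), t.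
    by move=> _ [u _ <-]; exact: tmax.
  apply: ub_le_sup; last by exists t.
  by exists (weight t) => _ [u _ <-]; exact: tmax.
by split=> [|u]; [exists t|exact: tmax].
Qed.

Let ok (s : swaps I) := all (fun q => adj q.1 q.2) s.
Let realizable (f : {perm vertex I}) := exists2 s : swaps I, ok s &
  forall pos : token I -> vertex I, forall t, placement pos s t = f (pos t).

Let realM f g : realizable f -> realizable g -> realizable (f * g)%g.
Proof.
move=> [s os Hs] [r rok Hr]; exists (s ++ r); first by rewrite /ok all_cat; apply/andP.
by move=> pos t; rewrite /placement foldl_cat -!/(placement _ _) Hr Hs permM.
Qed.

Let real_tperm x y : realizable (tperm x y).
Proof.
have /connectP[p ep ->] := adj_conn x y.
elim: p x ep => [|z p IH] x /=.
  by exists [::] => // pos t; rewrite tperm1 perm1.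
move=> /andP[xz /IH]; set w := last z p => H.
have rxz : realizable (tperm x z) by exists [:: (x, z)] => //; rewrite /ok /= xz.
have [->|wx] := eqVneq w x.
  by exists [::] => // pos t; rewrite tperm1 perm1.
have [->//|wz] := eqVneq w z.
have -> : tperm x w = (tperm z w ^ tperm x z)%g.
  by rewrite tpermJ tpermR tpermD // eq_sym.
by rewrite conjgE tpermV; apply: realM => //; exact: realM.
Qed.

Lemma valid_solution_exists : exists s : swaps I, valid_solution s.
Proof.
have [g gK Kg] := start_bij I.
have inj : injective (@dest R I \o g).
  by apply: inj_comp; [exact: bij_inj (dest_bij I)|exact: can_inj Kg].
have [s os Hs] : realizable (perm inj).
  case: (prod_tpermP (perm inj)) => ts -> _.
  elim: ts => [|q ts IH]; first by rewrite big_nil; exists [::] => // pos t; rewrite perm1.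
  by rewrite big_cons; apply: realM.
by exists s; split=> // t; rewrite Hs permE /= gK.
Qed.

Lemma min_weight_gt0 : 0 < min_weight I.
Proof. by have [[t <-] _] := min_weightP; exact: weight_gt0. Qed.

Lemma swaps_cost_ge (pos : token I -> vertex I) (s : swaps I) :
  bijective pos -> (size s)%:R * min_weight I <= swaps_cost (@weight R I) pos s.
Proof.
elim: s pos => [|q s IH] pos bp; first by rewrite mul0r.
rewrite /= -addn1 natrD addrC mulrDl mul1r lerD //; last first.
  by apply: IH; exact: (bij_comp (inv_bij (@tpermK _ q.1 q.2)) bp).
have [g _ Kg] := bp; rewrite /swap_cost (bigD1 (g q.1)) /= ?Kg ?eqxx //.
rewrite ler_wpDr //; last by have [_] := min_weightP.
by apply: sumr_ge0 => t _; exact/ltW/weight_gt0.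
Qed.

Lemma OPT_attained :
  (exists2 s : swaps I, valid_solution s & cost s = OPT I) /\
  (forall s : swaps I, valid_solution s -> OPT I <= cost s).
Proof.
have [s0 v0] := valid_solution_exists.
have w0 := min_weight_gt0.
pose N := (Num.truncn (cost s0 / min_weight I)).+1.
have short (s : swaps I) : cost s <= cost s0 -> (size s < N)%N.
  move=> le; rewrite /N ltnS -(ler_nat R) //.
  have h : (size s)%:R <= cost s0 / min_weight I.
    by rewrite ler_pdivlMr //; apply: le_trans (swaps_cost_ge s (start_bij I)) le.
  by rewrite ler_nat truncn_ge_nat // (le_trans _ h) // ler0n.
pose B := {k : 'I_N & k.-tuple (vertex I * vertex I)%type}.
pose sq (b : B) : swaps I := val (tagged b).
have onto (s : swaps I) : (size s < N)%N -> exists b, sq b = s.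
  by move=> h; exists (Tagged (fun k : 'I_N => k.-tuple _) (in_tuple s : (Ordinal h).-tuple _)).
have [b0 b0E] := onto s0 (short _ (lexx _)).
have vb0 : `[< valid_solution (sq b0) >] by apply/asboolP; rewrite b0E.
case: (@arg_minP _ _ _ b0 (fun b => `[< valid_solution (sq b) >])
   (fun b => cost (sq b)) vb0) => b /asboolP vb bmin.
have all_ge (s : swaps I) : valid_solution s -> cost (sq b) <= cost s.
  move=> vs; have [le|/ltW gt] := leP (cost s) (cost s0).
    by have [c cE] := onto s (short _ le); rewrite -cE bmin // cE; apply/asboolP.
  by apply: le_trans gt; rewrite -b0E bmin.
have -> : OPT I = cost (sq b).
  by apply: inf_min; [exists (sq b)|move=> _ [s vs <-]; exact: all_ge].
by split=> //; exists (sq b).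
Qed.

End Minima.
End Facts.

(* Main.v *)
(* Already unit weights, for which 1 + W/w = 2, defeat every such algorithm.  The tree is a
   path (the spine) of P vertices with K = c P leaves at its right end and K + P leaves at
   its left end.  The spine tokens are at home, the K right tokens must go left, and K
   left tokens must go right.  A good solution parks the spine tokens on P spare left
   leaves; after that, walking one token from right to left shifts a whole row of tokens
   to the right at no extra cost.  This takes about K P swaps, plus O(P^2) for parking and
   unparking.  If tokens stray by at most m, then all but 2 m of the spine tokens stay
   on the spine, and each of the 2 K travelling tokens must be swapped with each of them:
   about 2 K P swaps, since m = o(n) = o(P) when c is fixed.  The ratio tends to 2 when
   first P and then c grows. *)
Require Import Defs.
From HB Require Import structures.
From mathcomp Require Import all_boot all_order all_algebra all_fingroup.
From mathcomp Require Import all_classical all_reals all_analysis.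
From mathcomp Require Import zify ring lra.
Set Implicit Arguments.
Unset Strict Implicit.
Unset Printing Implicit Defensive.
Import Order.TTheory GRing.Theory Num.Theory.
Import numFieldNormedType.Exports.
Local Open Scope classical_set_scope.
Local Open Scope ring_scope.

(** * Swap sequences that carry tokens along walks *)

Section Walks.
Variable V : finType.
Implicit Types (s : seq (V * V)) (p : seq V) (v x : V).

(* [placement id s] is the map induced by [s] on vertices: the token on [v] moves to
   [placement id s v]. *)
Lemma placement_comp (T : finType) (pos : T -> V) s t :
  placement pos s t = placement id s (pos t).
Proof.
elim: s T pos t => // q s IH T pos t.
by rewrite /placement /= -!/(placement _ _) IH [RHS]IH.
Qed.

Lemma placement_cons q s v :
  placement id (q :: s) v = placement id s (tperm q.1 q.2 v).
Proof. exact: (@placement_comp V (swap_step id q)). Qed.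

Lemma placement_cat (T : finType) (pos : T -> V) s1 s2 t :
  placement pos (s1 ++ s2) t = placement id s2 (placement pos s1 t).
Proof. by rewrite -placement_comp /placement foldl_cat. Qed.

Lemma placement_revK s : cancel (placement id s) (placement id (rev s)).
Proof.
elim: s => // q s IH v; rewrite rev_cons -cats1 placement_cat.
by rewrite [placement id (q :: s) v]placement_cons IH placement_cons tpermK.
Qed.

Lemma placement_bij (T : finType) (pos : T -> V) s :
  bijective pos -> bijective (placement pos s).
Proof.
move=> bpos; apply: (eq_bij (f := placement id s \o pos)).
  apply: bij_comp bpos; exists (placement id (rev s)); first exact: placement_revK.
  by move=> v; rewrite -{1}[s]revK placement_revK.
by move=> t; rewrite /= -placement_comp.
Qed.

Lemma placement_take (T : finType) (pos : T -> V) s k (lt_ks : (k < size s)%N) q0 t :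
  placement pos (take k.+1 s) t =
    tperm (nth q0 s k).1 (nth q0 s k).2 (placement pos (take k s) t).
Proof. by rewrite (take_nth q0 lt_ks) -cats1 placement_cat. Qed.

(** These swaps carry the token on [x] to the end of [p]; along a simple path every other token
    moves one vertex back. [zip] drops the unmatched last vertex. *)
Definition walk x p : seq (V * V) := zip (x :: p) p.

Lemma size_walk x p : size (walk x p) = size p.
Proof. by rewrite size_zip /=; lia. Qed.

Lemma walk_adj (e : rel V) x p : all (fun q => e q.1 q.2) (walk x p) = path e x p.
Proof. by elim: p x => //= y p IH x; rewrite -IH. Qed.

Lemma placement_walk x p : placement id (walk x p) x = last x p.
Proof.
elim: p x => // y p IH x.
by rewrite placement_cons tpermL IH.
Qed.

Lemma placement_walk_out x p v : v \notin x :: p -> placement id (walk x p) v = v.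
Proof.
elim: p x => // y p IH x; rewrite !inE !negb_or => /and3P[vx vy vp].
rewrite placement_cons tpermD 1?eq_sym //.
by apply: IH; rewrite inE negb_or vy.
Qed.

Variables (x : nat -> V) (p : nat -> seq V).

Fixpoint walks n : seq (V * V) :=
  if n is m.+1 then walks m ++ walk (x m) (p m) else [::].

Lemma walks_adj (e : rel V) n :
  (forall i, (i < n)%N -> path e (x i) (p i)) ->
  all (fun q => e q.1 q.2) (walks n).
Proof.
elim: n => //= n IH H; rewrite all_cat walk_adj H // IH // => i lt_in.
by apply: H; lia.
Qed.

Lemma size_walks_le n b :
  (forall i, (i < n)%N -> (size (p i) <= b)%N) -> (size (walks n) <= n * b)%N.
Proof.
elim: n => //= n IH H; rewrite size_cat size_walk mulSn addnC leq_add ?H //.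
by apply: IH => i lt_in; apply: H; lia.
Qed.

Lemma placement_walks_out n v :
  (forall i, (i < n)%N -> v \notin x i :: p i) -> placement id (walks n) v = v.
Proof.
elim: n => //= n IH H; rewrite placement_cat IH => [|i lt_in].
  by apply: placement_walk_out; apply: H.
by apply: H; lia.
Qed.

(** No earlier walk disturbs the start of walk [i] and no later one its end, so walk [i] alone
    decides where the token goes. *)
Lemma placement_walks n i : (i < n)%N ->
  (forall j, (j < i)%N -> x i \notin x j :: p j) ->
  (forall j, (i < j < n)%N -> last (x i) (p i) \notin x j :: p j) ->
  placement id (walks n) (x i) = last (x i) (p i).
Proof.
move=> + Hx; elim: n => //= n IH; rewrite ltnS leq_eqVlt => /predU1P[<- _|lt_in Hy].
  by rewrite placement_cat placement_walks_out // placement_walk.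
rewrite placement_cat IH // => [|j /andP[ij jn]]; last by apply: Hy; lia.
by apply: placement_walk_out; apply: Hy; rewrite lt_in ltnS leqnn.
Qed.

End Walks.

(** * Trees given by a parent function *)

Section ParentTree.
Variables (V : finType) (root : V) (parent : V -> V) (depth : V -> nat).
Hypothesis depth_root : depth root = 0%N.
Hypothesis depth_eq0 : forall v, depth v = 0%N -> v = root.
Hypothesis depth_parent : forall v, depth (parent v) = (depth v).-1.

(** The root is its own parent; [u != v] removes the loop this would create. *)
Definition parent_adj : rel V :=
  [rel u v | (u != v) && ((parent u == v) || (parent v == u))].

Lemma parent_adj_sym : symmetric parent_adj.
Proof. by move=> u v; rewrite /parent_adj /= eq_sym orbC. Qed.

Lemma parent_adj_irr : irreflexive parent_adj.
Proof. by move=> u; rewrite /parent_adj /= eqxx. Qed.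

Lemma parent_root : parent root = root.
Proof. by apply: depth_eq0; rewrite depth_parent depth_root. Qed.

Lemma depth_gt0 v : v != root -> (0 < depth v)%N.
Proof. by apply: contraNT; rewrite -eqn0Ngt => /eqP/depth_eq0 ->. Qed.

Lemma parent_adj_depth u v : parent_adj u v ->
  v = parent u /\ depth u = (depth v).+1 \/ u = parent v /\ depth v = (depth u).+1.
Proof.
have H a b : a != b -> parent a = b -> b = parent a /\ depth a = (depth b).+1.
  move=> ab pab; split=> //; rewrite -pab depth_parent prednK // depth_gt0 //.
  by apply: contraNneq ab => ar; rewrite -pab ar parent_root.
case/andP=> uv /orP[]/eqP; first by left; apply: H.
by right; apply: H; rewrite 1?eq_sym.
Qed.

Lemma parent_adj_parent v : (0 < depth v)%N -> parent_adj v (parent v).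
Proof.
move=> dv; rewrite /parent_adj /= eqxx andbT; apply/eqP => E.
by have := depth_parent v; rewrite -E; lia.
Qed.

Lemma parent_tree : is_tree parent_adj.
Proof.
split=> [|c sz_c].
  have to_root v : connect parent_adj v root.
    have [n] := ubnP (depth v); elim: n v => // n IH v le_dn.
    have [/depth_eq0->//|dv] := posnP (depth v).
    apply: (connect_trans (connect1 (parent_adj_parent dv))).
    by apply: IH; rewrite depth_parent; lia.
  move=> u v; apply: connect_trans (to_root u) _.
  by rewrite (sym_connect_sym parent_adj_sym).
apply/negP => /andP[cyc uniq_c].
have [x0 x0c] : exists x0, x0 \in c.
  by case: c sz_c {cyc uniq_c} => // a c; exists a; rewrite mem_head.
case: (@arg_maxnP _ x0 (mem c) depth x0c) => x xc xmax.
(* Both cycle-neighbours of a deepest vertex of the cycle are its parent. *)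
have nbr y : y \in c -> parent_adj x y -> y = parent x.
  by move=> /xmax le /parent_adj_depth[[]//|[_]]; lia.
have [i c' rc] := rot_to xc.
have mem_c' y : y \in x :: c' -> y \in c by rewrite -rc mem_rot.
move: cyc uniq_c sz_c; rewrite -(rot_cycle i) -(rot_uniq i) -(size_rot i) rc.
case: c' mem_c' {rc} => [//|y c']; case/lastP: c' => [//|c' z] mem_c'.
rewrite (cycle_path x) /= last_rcons => /andP[zx /andP[xy _]] /and3P[_ + _] _.
have -> : y = parent x by apply: nbr => //; rewrite mem_c' // !inE eqxx orbT.
have <- : z = parent x.
  by apply: nbr; rewrite 1?parent_adj_sym // mem_c' // !inE mem_rcons mem_head !orbT.
by rewrite mem_rcons mem_head.
Qed.

(** The walk from [v] up to the root and on to [y], with [v] omitted; at the root itself it is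
    [[:: y]]. *)
Definition up_down v y := rcons (traject parent (parent v) (depth v)) y.

Lemma size_up_down v y : size (up_down v y) = (depth v).+1.
Proof. by rewrite size_rcons size_traject. Qed.

Lemma path_up_down v y : parent_adj root y -> path parent_adj v (up_down v y).
Proof.
move=> ry; rewrite /up_down.
have [n dv] : exists n, depth v = n by exists (depth v).
rewrite dv; elim: n v dv => [|n IH] v dv /=; first by rewrite (depth_eq0 dv) ry.
by rewrite parent_adj_parent ?dv //= IH // depth_parent dv.
Qed.

Lemma mem_up_down v y z : z \in v :: up_down v y ->
  [\/ z = v, z = y | (exists u, z = parent u) /\ (depth z <= depth v)%N].
Proof.
rewrite inE mem_rcons inE => /or3P[/eqP|/eqP|]; [by constructor 1|by constructor 2|].
case/trajectP=> i _ ->; rewrite -iterSr; constructor 3; split; first by exists (iter i parent v).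
elim: i => [|i IH]; first by rewrite /= depth_parent leq_pred.
by rewrite iterS depth_parent (leq_trans (leq_pred _)).
Qed.

End ParentTree.

(** * Counting swaps by crossings of heights *)

Lemma bool_switch (f : nat -> bool) n :
  f 0%N != f n -> exists2 k, (k < n)%N & f k != f k.+1.
Proof.
elim: n => [|n IH]; first by rewrite eqxx.
have [E fn|/IH[k lt_kn fk] _] := eqVneq (f 0%N) (f n); first by exists n; rewrite -?E.
by exists k => //; lia.
Qed.

Section Crossings.
Variables (V : finType) (e : rel V) (height : V -> nat).
Hypothesis e_height : forall u v, e u v ->
  height u = (height v).+1 \/ height v = (height u).+1.

Lemma height_path u p : path e u p ->
  (height u <= height (last u p) + size p)%N /\
  (height (last u p) <= height u + size p)%N.
Proof.
elim: p u => [|v p IH] u /=; first by lia.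
by case/andP=> /e_height uv /IH; lia.
Qed.

Lemma height_gdist u v : connect e u v ->
  (height u <= height v + gdist e u v)%N /\ (height v <= height u + gdist e u v)%N.
Proof. by case/gdist_attained => p [ep <- <-]; apply: height_path. Qed.

Variables (T : finType) (pos : T -> V) (s : seq (V * V)).
Hypothesis pos_bij : bijective pos.
Hypothesis s_adj : all (fun q => e q.1 q.2) s.

Let at_time k := placement pos (take k s).

(* A swap changes a height by at most one, and nothing shares the height of [h]; so two
   tokens can change order only by being swapped with each other. *)
Lemma crossing_swap t h :
    (forall k v, height v = height (at_time k h) -> v = at_time k h) ->
    (height (pos t) < height (pos h))%N !=
      (height (placement pos s t) < height (placement pos s h))%N ->
  exists k : 'I_(size s), forall q0, let q := nth q0 s k in
    at_time k t = q.1 /\ at_time k h = q.2 \/ at_time k t = q.2 /\ at_time k h = q.1.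
Proof.
move=> h_alone cross.
pose f k := (height (at_time k t) < height (at_time k h))%N.
have /bool_switch[k lt_ks fk] : f 0%N != f (size s).
  by rewrite /f /at_time take0 take_size.
exists (Ordinal lt_ks) => q0 /=; set q := nth q0 s k.
have q_adj : e q.1 q.2 by apply: (allP s_adj); apply: mem_nth.
have /e_height hq := q_adj.
have neq_th j : height (at_time j t) <> height (at_time j h).
  move=> /h_alone /(bij_inj (placement_bij (take j s) pos_bij)) E.
  by move: cross; rewrite E !ltnn.
have nk := neq_th k; have nk1 := neq_th k.+1.
move: fk nk1; rewrite /f /at_time !(placement_take pos lt_ks q0) -/q -!/(at_time _ _).
move: (at_time k t) (at_time k h) nk => a b nk.
by case: tpermP nk => [->|->|_ _] nk; case: tpermP nk => [->|->|_ _] nk; by [lia|auto].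
Qed.

(** Each pair has a time at which its tokens are swapped. One swap involves two tokens, and none is
    both an [a] and a [b], so distinct pairs have distinct times. *)
Lemma crossing_count (A B : finType) (a : A -> T) (b : B -> T) :
    injective a -> injective b -> (forall i j, a i <> b j) ->
    (forall j k v, height v = height (at_time k (b j)) -> v = at_time k (b j)) ->
    (forall i j, (height (pos (a i)) < height (pos (b j)))%N !=
      (height (placement pos s (a i)) < height (placement pos s (b j)))%N) ->
  (#|A| * #|B| <= size s)%N.
Proof.
move=> a_inj b_inj ab b_alone cross.
have /choice[f fP] (c : A * B) := crossing_swap (b_alone c.2) (cross c.1 c.2).
rewrite -card_prod -[size s]card_ord; apply: (@leq_card _ _ f) => -[i j] [i' j'] ff.
have /bij_inj inj := placement_bij (take (f (i, j)) s) pos_bij.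
have q0 : V * V := (pos (a i), pos (a i)).
move: (fP (i, j) q0) (fP (i', j') q0); rewrite -ff /= /at_time.
by move=> [[<- <-]|[<- <-]] [[/inj E1 /inj E2]|[/inj E1 /inj E2]];
  rewrite ?(a_inj _ _ E1) ?(b_inj _ _ E2) //; case: (ab _ _ E1).
Qed.

End Crossings.

Lemma unit_swaps_cost (R : realType) (V T : finType) (e : rel V) (pos : T -> V) s :
    irreflexive e -> bijective pos -> all (fun q => e q.1 q.2) s ->
  swaps_cost (fun=> 1 : R) pos s = 2 * (size s)%:R.
Proof.
move=> e_irr; elim: s pos => [|q s IH] pos pos_bij /=; first by rewrite mulr0.
case/andP=> q_adj s_adj; rewrite IH //; last exact: (placement_bij [:: q]).
have -> : swap_cost (fun=> 1 : R) pos q = 2; last by rewrite -natr1; lra.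
have [g gK Kg] := pos_bij.
have neq : g q.1 != g q.2.
  by apply: contraTneq q_adj => /(can_inj Kg) ->; rewrite e_irr.
have -> : 2 = #|[set g q.1; g q.2]%SET|%:R :> R by rewrite cards2 neq.
rewrite /swap_cost sumr_const; congr (_ *+ _); apply: eq_card => t.
by rewrite !inE unfold_in /= -(can2_eq gK Kg) -(can2_eq gK Kg).
Qed.

(** * The caterpillar instance and a cheap solution of it *)

Section Caterpillar.
Variables p q : nat.

(** Spine, garages for parking the spine tokens, left leaves, right leaves. The nesting puts all
    vertices hanging at the left end under [inl (inr _)]. *)
Definition caterpillar : finType := (('I_p.+1 + ('I_p.+1 + 'I_q.+1)) + 'I_q.+1)%type.

Definition spine i : caterpillar := inl (inl (inord i)).
Definition garage i : caterpillar := inl (inr (inl (inord i))).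
Definition left_leaf j : caterpillar := inl (inr (inr (inord j))).
Definition right_leaf j : caterpillar := inr (inord j).

Definition cat_parent (v : caterpillar) : caterpillar :=
  match v with
  | inl (inl i) => spine i.-1
  | inl (inr _) => spine 0
  | inr _ => spine p
  end.

Definition cat_depth (v : caterpillar) : nat :=
  match v with inl (inl i) => i | inl (inr _) => 1 | inr _ => p.+1 end.

(** Left-to-right position, whereas [cat_depth] is the distance to [spine 0]. A spine vertex is
    alone at its height, as crossings require. *)
Definition cat_height (v : caterpillar) : nat :=
  match v with inl (inl i) => i.+1 | inl (inr _) => 0 | inr _ => p.+2 end.

Definition cat_adj : rel caterpillar := parent_adj cat_parent.

Lemma depth_spine i : (i <= p)%N -> cat_depth (spine i) = i.
Proof. by move=> le_ip; rewrite /= inordK. Qed.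

Lemma height_spine i : (i <= p)%N -> cat_height (spine i) = i.+1.
Proof. by move=> le_ip; rewrite /= inordK. Qed.

Lemma height_inj v i : (i <= p)%N -> cat_height v = i.+1 -> v = spine i.
Proof.
case: v => [[k|k]|k] le_ip //= [E]; last by lia.
by congr (inl (inl _)); apply: val_inj; rewrite /= inordK.
Qed.

Lemma cat_depth0 v : cat_depth v = 0%N -> v = spine 0.
Proof. by case: v => [[i|]|] //= i0; apply: height_inj; rewrite //= i0. Qed.

Lemma cat_depth_parent v : cat_depth (cat_parent v) = (cat_depth v).-1.
Proof.
case: v => [[i|i]|i]; rewrite /cat_parent depth_spine //.
by have := ltn_ord i; rewrite /=; lia.
Qed.

Lemma cat_tree : is_tree cat_adj.
Proof. exact: parent_tree (depth_spine (leq0n p)) cat_depth0 cat_depth_parent. Qed.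

Lemma cat_adj_height u v : cat_adj u v ->
  cat_height u = (cat_height v).+1 \/ cat_height v = (cat_height u).+1.
Proof.
have H w : cat_parent w != w ->
    cat_height w = (cat_height (cat_parent w)).+1 \/
    cat_height (cat_parent w) = (cat_height w).+1.
  case: w => [[i|i]|i] iN; [left|by right; rewrite height_spine|by left; rewrite height_spine].
  have le_ip : (i.-1 <= p)%N by have := ltn_ord i; lia.
  rewrite height_spine //=; congr _.+1; rewrite prednK // lt0n.
  apply: contraNneq iN => i0; apply/eqP.
  by rewrite [cat_parent _]/= i0 -[RHS]/(inl (inl i)) -[in RHS](inord_val i) i0.
case/andP=> uv /orP[]/eqP E.
  by rewrite -E; apply: H; rewrite E eq_sym.
by case: (H v); rewrite E; auto.
Qed.

Local Notation route := (up_down cat_parent cat_depth).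

Definition evacuate := walks spine (fun i => route (spine i) (garage i)) p.+1.
Definition exchange := walks right_leaf (fun j => route (right_leaf j) (left_leaf j)) q.+1.
Definition reroute := evacuate ++ exchange ++ rev evacuate.

(** Every parent is a spine vertex, so between its ends a route meets only spine vertices no deeper
    than [v]. *)
Lemma notin_route v y z : z != v -> z != y ->
  (forall i, (i <= p)%N -> z = spine i -> (cat_depth v < i)%N) -> z \notin v :: route v y.
Proof.
move=> zv zy zN; apply/negP => /(mem_up_down cat_depth_parent)[|  |[[u zu]]].
- exact/eqP.
- exact/eqP.
have [i [le_ip zi]] : exists i, (i <= p)%N /\ z = spine i.
  rewrite zu; case: u {zu} => [[i|i]|i]; [exists i.-1|exists 0%N|exists p]; split=> //.
  by have := ltn_ord i; lia.
by have := zN i le_ip zi; rewrite zi depth_spine //; lia.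
Qed.

Lemma route_path v y :
  cat_parent y = spine 0 -> y != spine 0 -> path cat_adj v (route v y).
Proof.
move=> py yN; apply: (path_up_down (depth_spine (leq0n p)) cat_depth0 cat_depth_parent).
by rewrite /parent_adj /= py eqxx orbT eq_sym yN.
Qed.

Lemma reroute_adj : all (fun q => cat_adj q.1 q.2) reroute.
Proof.
have evac : all (fun q => cat_adj q.1 q.2) evacuate.
  by apply: walks_adj => i _; apply: route_path.
rewrite /reroute all_cat [all _ (exchange ++ _)]all_cat all_rev evac andbT.
by apply: walks_adj => i _; apply: route_path.
Qed.

Lemma size_reroute : (size reroute <= 2 * p.+1 ^ 2 + q.+1 * p.+2)%N.
Proof.
have evac : (size evacuate <= p.+1 * p.+1)%N.
  by apply: size_walks_le => i le_ip; rewrite size_up_down depth_spine.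
have exch : (size exchange <= q.+1 * p.+2)%N.
  by apply: size_walks_le => i le_ip; rewrite size_up_down.
rewrite /reroute size_cat [size (exchange ++ _)]size_cat size_rev -mulnn.
by move: evac exch; move: (size _) (size _) => a b; lia.
Qed.

Lemma eq_inord n i j : (i <= n)%N -> (j <= n)%N -> (inord i == inord j :> 'I_n.+1) = (i == j).
Proof. by move=> le_in le_jn; rewrite -val_eqE /= !inordK. Qed.

(** The order from left to right matters: routes from shallower spine vertices do not reach
    [spine i], and later routes avoid [garage i]. *)
Lemma evacuate_spine i : (i <= p)%N -> placement id evacuate (spine i) = garage i.
Proof.
move=> le_ip; rewrite /evacuate placement_walks ?last_rcons // => j; last first.
  move=> /andP[ij jp]; apply: notin_route => //; rewrite /garage.
  by rewrite -[_ == _]/(inord i == inord j :> 'I_p.+1) eq_inord //; lia.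
move=> ji; apply: notin_route => //.
  by rewrite -[_ == _]/(inord i == inord j :> 'I_p.+1) eq_inord //; lia.
move=> k le_kp /(congr1 cat_depth); rewrite !depth_spine //; lia.
Qed.

Lemma evacuate_leaf j :
  placement id evacuate (left_leaf j) = left_leaf j /\
  placement id evacuate (right_leaf j) = right_leaf j.
Proof. by split; apply: placement_walks_out => i _; apply: notin_route. Qed.

Lemma exchange_garage i : placement id exchange (garage i) = garage i.
Proof. by apply: placement_walks_out => j _; apply: notin_route. Qed.

Lemma exchange_right j : (j <= q)%N ->
  placement id exchange (right_leaf j) = left_leaf j.
Proof.
move=> le_jq; rewrite /exchange placement_walks ?last_rcons // => k; last first.
  move=> jk; apply: notin_route => //.
  by rewrite -[_ == _]/(inord j == inord k :> 'I_q.+1) eq_inord //; lia.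
move=> jk; apply: notin_route => //.
by rewrite -[_ == _]/(inord j == inord k :> 'I_q.+1) eq_inord //; lia.
Qed.

Lemma reroute_spine i : (i <= p)%N -> placement id reroute (spine i) = spine i.
Proof.
move=> le_ip; rewrite /reroute placement_cat [placement _ (exchange ++ _) _]placement_cat.
rewrite evacuate_spine // exchange_garage.
by rewrite -(evacuate_spine le_ip) placement_revK.
Qed.

Lemma reroute_right j : (j <= q)%N -> placement id reroute (right_leaf j) = left_leaf j.
Proof.
move=> le_jq; rewrite /reroute placement_cat [placement _ (exchange ++ _) _]placement_cat.
rewrite (evacuate_leaf j).2 exchange_right //.
(* [evacuate] fixes the left leaf, hence so does its reversal. *)
by rewrite -{1}(evacuate_leaf j).1 placement_revK.
Qed.

(* Every token that is not on the left starts on the spine, where it is already at home,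
   or on the right, from where it is sent to the left. *)
Lemma reroute_to_right v j : placement id reroute v = right_leaf j -> cat_height v = 0%N.
Proof.
case: v => [[i|//]|k]; [rewrite -[i]inord_val -/(spine i)|rewrite -[k]inord_val -/(right_leaf k)].
  by rewrite reroute_spine // -ltnS.
by rewrite reroute_right // -ltnS.
Qed.

Lemma card_caterpillar : #|caterpillar| = (2 * (p.+1 + q.+1))%N.
Proof. by rewrite !card_sum !card_ord; lia. Qed.

Variable R : realType.

(** Tokens are named by their starting vertices, and destinations are read off from [reroute], which
    is thus valid by construction. *)
Definition cat_instance : instance R.
Proof.
refine (@Instance R caterpillar caterpillar cat_adj (fun=> 1) id (placement id reroute)
  _ (parent_adj_sym _) (parent_adj_irr _) cat_tree.1 (fun=> ltr01) _ _).
- by rewrite card_caterpillar.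
- by exists id.
- by apply: placement_bij; exists id.
Defined.

Definition cat_tree_instance : tree_instance R := @TreeInstance R cat_instance cat_tree.

Lemma cat_weights : min_weight cat_instance = 1 /\ max_weight cat_instance = 1.
Proof.
by have [[[t <-] _] [[u <-] _]] := (min_weightP cat_instance, max_weightP cat_instance).
Qed.

Lemma cat_cost (s : swaps cat_instance) : all (fun q => cat_adj q.1 q.2) s ->
  cost s = 2 * (size s)%:R.
Proof. by apply: unit_swaps_cost; [exact: parent_adj_irr|exists id]. Qed.

Lemma cat_OPT_le : OPT cat_instance <= 2 * (2 * p.+1 ^ 2 + q.+1 * p.+2)%:R.
Proof.
have [_ OPT_le] := OPT_attained cat_instance.
apply: le_trans (OPT_le reroute _) _; first by split; [exact: reroute_adj|].
by rewrite cat_cost ?reroute_adj // ler_pM2l // ler_nat size_reroute.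
Qed.

(** * Lower bound for straying solutions *)

Lemma near_home (l : R) m i k (s : swaps cat_instance) :
    l < m.+1%:R -> (i <= p)%N -> straying_solution l s ->
  let v := placement id (take k s) (spine i) in
  (cat_height v <= i.+1 + m /\ i.+1 <= cat_height v + m)%N.
Proof.
move=> lm le_ip /(_ k (spine i))[u].
have -> : token_path (I := cat_instance) (spine i) = [:: spine i].
  rewrite /token_path /= reroute_spine //; congr (_ :: _).
  (* A simple path from a vertex to itself is empty. *)
  have /the_path_simple/and3P[_] : connect cat_adj (spine i) (spine i) by [].
  by case: the_path => // w r /eqP /= {1}<-; rewrite mem_last.
rewrite inE => /eqP -> near.
have {near}dm : (gdist cat_adj (placement id (take k s) (spine i)) (spine i) <= m)%N.
  by rewrite -ltnS -(ltr_nat R); apply: le_lt_trans near lm.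
have := height_gdist cat_adj_height
  (cat_tree.1 (placement id (take k s) (spine i)) (spine i)).
by rewrite height_spine // => -[h1 h2]; split; lia.
Qed.

(* The spine tokens with at least m spine vertices on either side never leave the spine.
   Each of them must therefore be swapped with each of the q.+1 tokens that start on the
   right and with each of the q.+1 tokens that end there. *)
Lemma straying_size (l : R) m (s : swaps cat_instance) :
    l < m.+1%:R -> valid_solution s -> straying_solution l s ->
  (2 * q.+1 * (p.+1 - 2 * m) <= size s)%N.
Proof.
move=> lm [s_adj s_valid] s_stray.
have start_bij : bijective (id : caterpillar -> caterpillar) by exists id.
(* Tokens that start on the right, then tokens that end there, found by running [reroute]
   backwards. *)
pose a (c : 'I_q.+1 + 'I_q.+1) : caterpillar := match c with
  inl j => right_leaf j | inr j => placement id (rev reroute) (right_leaf j) end.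
pose b (i : 'I_(p.+1 - 2 * m)) : caterpillar := spine (m + i).
have b_le (i : 'I_(p.+1 - 2 * m)) : (m + i + m <= p)%N by have := ltn_ord i; lia.
have a_dest j : placement id reroute (a (inr j)) = right_leaf j.
  by rewrite -{1}[reroute]revK placement_revK.
have a_height j : cat_height (a (inr j)) = 0%N := reroute_to_right (a_dest j).
have right_inj : injective (fun j : 'I_q.+1 => right_leaf j).
  by move=> j j' [/eqP]; rewrite !inord_val => /eqP.
have := @crossing_count _ cat_adj cat_height cat_adj_height _ id s start_bij s_adj _ _ a b.
rewrite card_sum !card_ord addnn -mul2n; apply.
(* The two kinds are disjoint: tokens bound for the right start at height 0. *)
- move=> [j|j] [j'|j'] E.
  + by rewrite (right_inj _ _ E).
  + by have := a_height j'; rewrite -E.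
  + by have := a_height j; rewrite E.
  + by congr inr; apply: right_inj; rewrite -!a_dest E.
- move=> i i' /(congr1 cat_height); rewrite !height_spine //; first last.
  + by have := b_le i; lia.
  + by have := b_le i'; lia.
  by move=> E; apply: ord_inj; lia.
- move=> [j|j] i E.
  + by have := congr1 cat_height E; rewrite height_spine /=; have := b_le i; lia.
  + by have := a_height j; rewrite E height_spine //; have := b_le i; lia.
- move=> i k v hv; have := b_le i => bi.
  have le_ip : (m + i <= p)%N by lia.
  have [h1 h2] := near_home k lm le_ip s_stray.
  (* The height stays between 1 and [p.+1], which are exactly the spine heights. *)
  have [r rp Er] : exists2 r, (r <= p)%N & cat_height (placement id (take k s) (b i)) = r.+1.
    by exists (cat_height (placement id (take k s) (b i))).-1; rewrite /b; lia.
  by rewrite (height_inj rp Er); apply: height_inj; rewrite // hv.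
move=> c i; have bi := b_le i; have le_ip : (m + i <= p)%N by lia.
have valid t : placement id s t = placement id reroute t := s_valid t.
rewrite !valid reroute_spine // height_spine //.
case: c => j; first by rewrite reroute_right -1?ltnS //=; lia.
by rewrite a_dest a_height /=; lia.
Qed.

End Caterpillar.

(** * Choice of parameters and conclusion *)

Lemma powR_bigO_sublinear (R : realType) (l : nat -> R) (eps eta : R) :
    0 < eps -> 0 < eta -> l =O_\oo (fun n : nat => n%:R `^ (1 - eps)) ->
  exists N, forall n, (N <= n)%N -> l n <= eta * n%:R.
Proof.
move=> eps_gt0 eta_gt0 /eqO_exP[C C_gt0 [N _ lC]].
(* Beyond this threshold $n^{eps} \ge C / eta$, so $C n^{1-eps} \le eta \, n$. *)
exists (maxn N (Num.truncn ((C / eta) `^ eps^-1)).+1) => n.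
rewrite geq_max => /andP[/lC /= ln large].
have n_gt0 : 0 < n%:R :> R by rewrite ltr0n; lia.
have {large} eta_le : C / eta <= n%:R `^ eps.
  have C_ge0 : 0 <= C / eta by rewrite ltW ?divr_gt0.
  have <- : ((C / eta) `^ eps^-1) `^ eps = C / eta.
    by rewrite -powRrM mulVf ?lt0r_neq0 // powRr1.
  apply: ge0_ler_powR; rewrite ?nnegrE ?powR_ge0 ?ltW //.
  by apply: lt_le_trans (truncnS_gt _) _; rewrite ler_nat.
apply: le_trans (ler_norm _) (le_trans ln _).
rewrite ger0_norm ?powR_ge0 // powRB ?lt0r_neq0 ?implybT // powRr1 ?ler0n //.
have e_gt0 : 0 < n%:R `^ eps by rewrite powR_gt0.
rewrite mulrCA mulrC ler_pM2r // ler_pdivrMr //.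
by move: eta_le; rewrite ler_pdivrMr // mulrC.
Qed.

(** With $P = p + 1$, the 8 splits as 4 + 2 + 2: parking costs at most $4P^2$ after scaling by $2 -
    d$, straying saves at most $4cmP \le 2P^2$, and the extra step of each exchange walk costs at
    most $2cP < 2P^2$. *)
Lemma caterpillar_arith (R : realType) (d : R) (c p m S : nat) :
    0 < d -> 8 <= d * c%:R -> (0 < c <= p)%N -> (2 * c * m <= p.+1)%N ->
    (2 * (c * p.+1) * (p.+1 - 2 * m) <= S)%N ->
  (2 - d) * (2 * p.+1 ^ 2 + c * p.+1 * p.+2)%:R < S%:R :> R.
Proof.
move=> d_gt0 dc /andP[c_gt0 le_cp] cm.
have {cm} cm : (2 * c * m * p.+1 <= p.+1 * p.+1)%N by rewrite leq_mul2r cm.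
rewrite mulnBr leq_subLR => S_ge.
have {}S_ge : (2 * (c * p.+1) * p.+1 <= S + 2 * p.+1 * p.+1)%N by nia.
have {}S_ge : 2 * (c%:R * p.+1%:R) * p.+1%:R <= S%:R + 2 * p.+1%:R * p.+1%:R :> R.
  by rewrite -!natrM -natrD ler_nat.
have cp : c%:R + 1 <= p.+1%:R :> R by rewrite natr1 ler_nat.
rewrite natrD !natrM -[p.+2%:R]natr1.
have {}c_gt0 : 0 < c%:R :> R by rewrite ltr0n.
move: (p.+1%:R) (c%:R) (S%:R) cp S_ge dc c_gt0 => P C D cp S_ge dc c_gt0.
have P_gt0 : 0 < P by lra.
have dCP : 8 * (P * P) <= d * C * (P * P) by rewrite ler_wpM2r // mulr_ge0 // ltW.
have dP : 0 <= d * (P * P) by rewrite !mulr_ge0 // ltW.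
have dCP1 : 0 <= d * C * P by rewrite !mulr_ge0 // ltW.
have CPP : C * P < P * P by rewrite ltr_pM2r //; lra.
lra.
Qed.

Theorem theorem2 (R : realType) (eps delta : R)
    (eps_gt0 : 0 < eps) (delta_gt0 : 0 < delta) :
  ~ exists A : tree_algorithm R,
      O_straying (1 - eps) A /\
      forall I : tree_instance R,
        valid_solution (A I) /\
        cost (A I) <= (1 + max_weight I / min_weight I - delta) * OPT I.
Proof.
move=> [A [[l [lO l_stray]] A_approx]].
(* The cap at 1 keeps $2 - d$ positive, so that the upper bound on [OPT] may be multiplied by it. *)
pose d := Num.min delta 1.
have d_gt0 : 0 < d by rewrite lt_min delta_gt0 ltr01.
have [c [c_gt0 dc]] : exists c, (0 < c)%N /\ 8 <= d * c%:R.
  exists (Num.truncn (8 / d)).+1; split=> //.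
  by rewrite mulrC -ler_pdivrMr // ltW // truncnS_gt.
(* Since $n = 2(c+1)P$, this slope gives $l(n) \le P / (2c)$. *)
have eta_gt0 : 0 < (4 * c * c.+1)%:R^-1 :> R by rewrite invr_gt0 ltr0n !muln_gt0 c_gt0.
have [N l_le] := powR_bigO_sublinear eps_gt0 eta_gt0 lO.
have [p [le_Np le_cp]] : exists p, (N <= p)%N /\ (c <= p)%N.
  by exists (N + c)%N; rewrite leq_addr leq_addl.
have [q q1] : exists q, q.+1 = (c * p.+1)%N.
  by exists (c * p.+1).-1; rewrite prednK // muln_gt0 c_gt0.
have [m [l_lt cm]] : exists m, l #|caterpillar p q| < m.+1%:R /\ (2 * c * m <= p.+1)%N.
  have -> : #|caterpillar p q| = (2 * c.+1 * p.+1)%N.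
    by rewrite card_caterpillar q1 -mulSn mulnA.
  set n := (2 * c.+1 * p.+1)%N; exists (Num.truncn (l n)); split; first exact: truncnS_gt.
  (* [l n] may be negative, and then its truncation is 0. *)
  have [->|m_gt0] := posnP (Num.truncn (l n)); first by rewrite muln0.
  have le_Nn : (N <= n)%N.
    by rewrite (leq_trans le_Np) // (leq_trans (leqnSn p)) // leq_pmull.
  have : (Num.truncn (l n))%:R <= l n.
    by rewrite truncn_le (le_trans ler01) // -truncn_gt0.
  move=> /le_trans /(_ (l_le n le_Nn)).
  have -> : (4 * c * c.+1)%:R^-1 * n%:R = p.+1%:R / (2 * c)%:R :> R.
    by rewrite !natrM; field; rewrite nat1r !pnatr_eq0 -lt0n c_gt0.
  by rewrite ler_pdivlMr ?ltr0n ?muln_gt0 // -natrM ler_nat mulnC.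
pose I := cat_tree_instance p q R.
have [A_valid A_cost] := A_approx I.
have := straying_size l_lt A_valid (l_stray I).
rewrite q1 => /(caterpillar_arith d_gt0 dc _ cm); rewrite c_gt0 le_cp => /(_ isT).
apply/negP; rewrite -leNgt -q1.
have OPT_le := cat_OPT_le p q R.
have OPT_ge0 : 0 <= OPT I.
  by have [[s [s_adj _] <-] _] := OPT_attained I; rewrite cat_cost // mulr_ge0.
have [w1 W1] := cat_weights p q R.
move: A_cost; rewrite cat_cost; last by case: A_valid.
rewrite w1 W1 divr1 => A_cost.
rewrite -(ler_pM2l (_ : 0 < 2 :> R)) // (le_trans A_cost) // mulrCA.
have d1 : d <= 1 by rewrite ge_min lexx orbT.
apply: (@le_trans _ _ ((2 - d) * OPT I)); last by rewrite ler_wpM2l //; lra.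
by rewrite ler_wpM2r // (_ : 1 + 1 = 2) // lerB // ge_min lexx.
Qed.
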